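(* For every admissible finite simple graph $G$, $\mathrm{Maj}'(G)\le 8$.
   Context: Graphs are finite, simple and undirected. Two distinct edges are adjacent if they share an endpoint. An edge-coloring $c:E\to C$ (not necessarily proper) of a graph $G=(V,E)$ is a strong majority edge-coloring if for every edge $e\in E$ and every color $\alpha\in C$, at most half of the edges adjacent to $e$ have color $\alpha$ (i.e., no color $\alpha$ occurs on more edges adjacent to $e$ than the other colors together). A graph is admissible if it has no vertex of degree $1$ adjacent to a vertex of degree $2$; exactly the admissible graphs admit a strong majority edge-coloring. The strong majority index $\mathrm{Maj}'(G)$ of an admissible graph $G$ is the least number of colors in a strong majority edge-coloring of $G$. *)

(* Defs.v *)
From mathcomp Require Import all_boot.

Set Implicit Arguments.
Unset Strict Implicit.
Unset Printing Implicit Defensive.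

Record sgraph := SGraph {
  vertex :> finType;
  adjacent : rel vertex;
  adjacent_sym : symmetric adjacent;
  adjacent_irrefl : irreflexive adjacent }.

Section Graph.
Variable G : sgraph.
Implicit Types u v w : G.

Definition degree v := #|[set w | adjacent v w]|.

Definition admissible : bool :=
  ~~ [exists u, exists v, [&& adjacent u v, degree u == 1 & degree v == 2]].

Definition edge_set : {set {set G}} :=
  [set e | [exists u, exists v, adjacent u v && (e == [set u; v])]].

Definition edge := {e : {set G} | e \in edge_set}.

Definition edge_adjacent (e f : edge) : bool :=
  (e != f) && (val e :&: val f != set0).

Definition strong_majority (C : finType) (c : {ffun edge -> C}) : bool :=
  [forall e : edge, forall a : C,
     2 * #|[set f | edge_adjacent e f & c f == a]|
       <= #|[set f | edge_adjacent e f]|].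

Definition strong_majority_colorable (k : nat) : bool :=
  [exists c : {ffun edge -> 'I_k}, strong_majority c].

Lemma edge_ex u v : adjacent u v -> exists e : edge, val e = [set u; v].
Proof.
move=> uv; have uvE : [set u; v] \in edge_set.
  by rewrite inE; apply/existsP; exists u; apply/existsP; exists v; rewrite uv /=.
by exists (exist (fun e : {set G} => e \in edge_set) _ uvE).
Qed.

Lemma edgeP (e : edge) : exists u v, adjacent u v /\ val e = [set u; v].
Proof.
case: e => e /= eE; move: (eE); rewrite inE.
by case/existsP=> u /existsP[v /andP[uv /eqP ->]]; exists u, v.
Qed.

Lemma adjacent_neq u v : adjacent u v -> u != v.
Proof. by apply: contraTneq => ->; rewrite adjacent_irrefl. Qed.

Lemma edge_pivot (e f : edge) : edge_adjacent e f ->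
  exists u v w, [/\ adjacent u v, adjacent u w, v != w,
                    val e = [set u; v] & val f = [set u; w]].
Proof.
case/andP=> ef /set0Pn[x /setIP[xe xf]].
have pivot (g : edge) : x \in val g ->
    exists2 y, adjacent x y & val g = [set x; y].
  have [u [v [uv ->]]] := edgeP g; rewrite !inE => /orP[]/eqP->.
    by exists v.
  by exists u; rewrite 1?adjacent_sym // setUC.
have [v xv Ee] := pivot _ xe; have [w xw Ef] := pivot _ xf.
exists x, v, w; split=> //; apply: contraNneq ef => vw.
by apply/eqP/val_inj; rewrite Ee Ef vw.
Qed.

Lemma admissible_second_adjacent (e f : edge) : admissible ->
  edge_adjacent e f -> exists2 g, edge_adjacent e g & g != f.
Proof.
move=> admG /edge_pivot[u [v [w [uv uw vw Ee Ef]]]].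
have nuv := adjacent_neq uv; have nuw := adjacent_neq uw.
have [sub|] := boolP ([set x | adjacent u x] \subset [set v; w]).
  have du : degree u = 2.
    rewrite /degree; have -> : [set x | adjacent u x] = [set v; w].
      apply/eqP; rewrite eqEsubset sub; apply/subsetP=> x.
      by rewrite !inE => /orP[]/eqP->.
    by rewrite cards2 vw.
  have [sub1|] := boolP ([set x | adjacent v x] \subset [set u]).
    case/negP: admG; apply/existsP; exists v; apply/existsP; exists u.
    rewrite adjacent_sym uv du eqxx andbT /=; apply/cards1P; exists u.
    apply/eqP; rewrite eqEsubset sub1; apply/subsetP=> x.
    by rewrite !inE => /eqP->; rewrite adjacent_sym.
  case/subsetPn=> x; rewrite !inE => vx xu.
  have nvx := adjacent_neq vx; have [g Eg] := edge_ex vx; exists g.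
    apply/andP; split; last by apply/set0Pn; exists v; rewrite Ee Eg !inE !eqxx orbT.
    apply: contraNneq xu => eg; have: x \in val e by rewrite eg Eg !inE eqxx orbT.
    by rewrite Ee !inE eq_sym [x == v]eq_sym (negPf nvx) orbF eq_sym.
  apply: contraNneq vw => gf; have: v \in val f by rewrite -gf Eg !inE eqxx.
  by rewrite Ef !inE eq_sym (negPf nuv).
case/subsetPn=> x; rewrite !inE negb_or => ux /andP[xv xw].
have nux := adjacent_neq ux; have [g Eg] := edge_ex ux; exists g.
  apply/andP; split; last by apply/set0Pn; exists u; rewrite Ee Eg !inE !eqxx.
  apply: contraNneq xv => eg; have: x \in val e by rewrite eg Eg !inE eqxx orbT.
  by rewrite Ee !inE eq_sym (negPf nux).
apply: contraNneq xw => gf; have: x \in val f by rewrite -gf Eg !inE eqxx orbT.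
by rewrite Ef !inE eq_sym (negPf nux).
Qed.

(* Giving all edges distinct colors works, so the minimum below is taken over
   a nonempty set of natural numbers. *)
Lemma admissible_colorable :
  admissible -> exists k, strong_majority_colorable k.
Proof.
move=> admG; exists #|{: edge}|; apply/existsP.
exists [ffun e => enum_rank e]; apply/forallP=> e; apply/forallP=> a.
set A := [set f | _ & _].
have [->|[f]] := set_0Vmem A; first by rewrite cards0.
rewrite !inE ffunE => /andP[ef /eqP fa].
have [g eg gf] := admissible_second_adjacent admG ef.
have -> : A = [set f].
  apply/setP=> h; rewrite !inE ffunE -fa (inj_eq enum_rank_inj) andbC.
  by case: eqP => // ->.
rewrite cards1 muln1 -[2]/(true.+1) -gf -cards2.
apply/subset_leq_card/subsetP=> h.
by rewrite !inE => /orP[]/eqP->.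
Qed.

Definition strong_majority_index (admG : admissible) : nat :=
  ex_minn (admissible_colorable admG).

End Graph.

(* Main.v *)
Require Import Defs.
From mathcomp Require Import all_boot zify.

Set Implicit Arguments.
Unset Strict Implicit.
Unset Printing Implicit Defensive.

(* Cut the edges around each vertex into blocks of at most four, and give
   distinct colors to the edges of a block: a color then occurs at most
   ceil(d/4) times at a vertex of degree d, which is at most (d-1)/2 unless
   d = 2.  A vertex of degree 2 with no neighbor of degree 2 is suppressed, its
   two edges sharing one color.  On longer threads of vertices of degree 2,
   edges at distance one get distinct colors, and an edge with both ends of
   degree 2, colored last, also avoids the colors of the last three edges around
   a vertex w at the end of the thread: a color missing there occurs at most
   ceil((d(w)-3)/4) <= d(w)/2 - 1 times at w.  Every color class so prescribed
   has at most three conflicts on each of its two sides, so 7 colors suffice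
   greedily. *)

(* Coloring by increasing h, only conflicts with earlier elements matter, hence
   R need not be symmetric between different levels. *)
Lemma greedy_coloring (T : finType) (k : nat) (h : T -> nat) (R : rel T) :
    (forall x, #|[set y | R x y]| <= k) ->
    (forall x y, R x y -> R y x \/ h y < h x) ->
  exists c : T -> 'I_k.+1, forall x y, R x y -> x != y -> c x != c y.
Proof.
move=> degR symR.
suff [c cP] : exists c : T -> 'I_k.+1, forall x y,
    x \in [set: T] -> y \in [set: T] -> R x y -> x != y -> c x != c y.
  by exists c => x y; apply: cP; rewrite inE.
move: {2}#|_| (leqnn #|[set: T]|) => n; elim: n [set: T] => [|n IHn] S.
  rewrite leqn0 cards_eq0 => /eqP->.
  by exists (fun=> ord0) => x y; rewrite inE.
move=> leSn; have [->|[x0 Sx0]] := set_0Vmem S.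
  by exists (fun=> ord0) => x y; rewrite inE.
(* The element [x] of maximal level is colored last. A relation [R y x] without [R x y] would force
   [h x < h y], against maximality, so only the at most [k] elements [y] with [R x y] constrain its
   color. *)
case: (arg_maxnP h Sx0) => x Sx maxx; have {}Sx : x \in S := Sx.
have [|c cP] := IHn (S :\ x); first by move: leSn; rewrite (cardsD1 x) Sx.
have [a aP] : exists a, a \notin c @: [set y | R x y].
  apply/existsP; rewrite -negb_forall; apply/negP => /forallP all_in.
  have := leq_trans (leq_imset_card c _) (degR x).
  rewrite leqNgt => /negP[]; rewrite -[X in X <= _](card_ord k.+1) -cardsT.
  by apply/subset_leq_card/subsetP => a _.
have aR y : R x y -> a != c y.
  by move=> Rxy; apply: contraNneq aP => ->; apply/imsetP; exists y; rewrite ?inE.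
exists (fun y => if y == x then a else c y) => y z Sy Sz Ryz neq_yz.
case: (eqVneq y x) (eqVneq z x) => [yx|yx] [zx|zx].
- by rewrite yx zx eqxx in neq_yz.
- by apply: aR; rewrite -yx.
- rewrite eq_sym; apply: aR; rewrite zx in Ryz.
  have [//|lt_xy] := symR _ _ Ryz.
  by have := maxx y Sy; rewrite /= leqNgt lt_xy.
- by apply: cP; rewrite // !inE ?yx ?zx.
Qed.

Section MajorityColoring.
Variable G : sgraph.
Implicit Types (u v w x y : G) (A B Z : {set G}).

Definition nbrs v : {set G} := [set w | adjacent v w].

Lemma in_nbrs v w : (w \in nbrs v) = adjacent v w.
Proof. by rewrite inE. Qed.

Lemma card_nbrs v : #|nbrs v| = degree v.
Proof. by []. Qed.

Lemma nbrsC v w : (w \in nbrs v) = (v \in nbrs w).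
Proof. by rewrite !inE adjacent_sym. Qed.

Lemma nbrs_neq v w : w \in nbrs v -> v != w.
Proof. by rewrite inE => /adjacent_neq. Qed.

Lemma degree2_other u v : degree v = 2 -> u \in nbrs v ->
  exists x, nbrs v :\ u = [set x].
Proof.
move=> dv uv; apply/cards1P.
by move: dv; rewrite -card_nbrs (cardsD1 u) uv => /eqP.
Qed.

(** * Blocks of four among the edges around a vertex *)

Definition rank v x := index x (enum (nbrs v)).
Definition block v x := rank v x %/ 4.

Lemma rank_lt v x : x \in nbrs v -> rank v x < degree v.
Proof. by move=> vx; rewrite -card_nbrs cardE index_mem mem_enum. Qed.

Lemma rank_inj v : {in nbrs v &, injective (rank v)}.
Proof.
move=> x y vx vy eqr; have ex: x \in enum (nbrs v) by rewrite mem_enum.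
have ey: y \in enum (nbrs v) by rewrite mem_enum.
by rewrite -(nth_index x ex) -(nth_index x ey) -/(rank v x) eqr.
Qed.

Lemma card_inj_iota (S : {set G}) (f : G -> nat) m n :
  {in S &, injective f} -> {in S, forall x, m <= f x < m + n} -> #|S| <= n.
Proof.
move=> injf bf; rewrite cardE -(size_map f) -(size_iota m n).
apply: uniq_leq_size.
  by rewrite map_inj_in_uniq ?enum_uniq // => x y; rewrite !mem_enum; apply: injf.
by move=> _ /mapP[x + ->]; rewrite mem_enum mem_iota; apply: bf.
Qed.

(** Ranks below [m] meet at most ceil(m/4) blocks; the bound is multiplied out to avoid rounding. *)
Lemma card_separated v (S : {set G}) m :
    {in S &, injective (block v)} -> {in S, forall x, rank v x < m} ->
  4 * #|S| <= m + 3.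
Proof.
move=> injb ltm.
suff: #|S| <= (m + 3) %/ 4 by lia.
apply: (@card_inj_iota S (block v) 0) => // x /ltm.
by rewrite /block add0n /=; lia.
Qed.

Definition blockmates v u :=
  [set x in nbrs v | (x != u) && (block v x == block v u)].

(** A color missing on these edges occurs at [v] only at ranks below [degree v - 3]. If the degree
    is at most 3, this is all of [nbrs v]. *)
Definition last3 v := [set x in nbrs v | degree v <= rank v x + 3].

(** A block spans four consecutive ranks, one of which is taken by [u]. *)
Lemma card_blockmates v u : u \in nbrs v -> #|blockmates v u| <= 3.
Proof.
move=> vu; have : #|u |: blockmates v u| <= 4.
  apply: (@card_inj_iota _ (rank v) (4 * block v u)) => [x y|x].
    rewrite !inE -!in_nbrs => /orP Hx /orP Hy.
    apply: rank_inj; [case: Hx | case: Hy]; by [move=> /eqP-> | case/andP].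
  by rewrite !inE => /orP[/eqP->|/and3P[_ _ /eqP]]; rewrite /block; lia.
by rewrite cardsU1 !inE eqxx andbF /=; lia.
Qed.

Lemma card_last3 v : #|last3 v| <= 3.
Proof.
apply: (@card_inj_iota _ (rank v) (degree v - 3)) => [x y|x].
  by rewrite !inE -!in_nbrs => /andP[vx _] /andP[vy _]; apply: rank_inj.
by rewrite inE => /andP[/rank_lt]; lia.
Qed.

(** * Suppressed vertices, traces and forbidden colors *)

Definition suppressed v := (degree v == 2) && [forall x in nbrs v, degree x != 2].

Lemma two_nbrs_suppressed v u x : degree v = 2 -> u \in nbrs v ->
  x \in nbrs v -> x != u -> degree u != 2 -> degree x != 2 -> suppressed v.
Proof.
move=> dv vu vx xu du dx; rewrite /suppressed dv eqxx /=; apply/forall_inP=> y vy.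
have [z Ez] := degree2_other dv vu; have [->//|yu] := eqVneq y u.
have: y \in nbrs v :\ u by rewrite in_setD1 yu.
have: x \in nbrs v :\ u by rewrite in_setD1 xu.
by rewrite Ez !in_set1 => /eqP<- /eqP->.
Qed.

(* For an edge A, the union of the edges bound to have the color of A: the colors
   are attached to traces rather than to edges. *)
Definition trace A := A :|: \bigcup_(v in A | suppressed v) nbrs v.

Lemma sub_trace A : A \subset trace A.
Proof. exact: subsetUl. Qed.

Lemma suppressed_degree v : suppressed v -> degree v = 2.
Proof. by case/andP=> /eqP. Qed.

Lemma suppressed_nbr v x : suppressed v -> x \in nbrs v -> degree x != 2.
Proof. by case/andP=> _ /forall_inP; apply. Qed.

Lemma not_suppressed v : degree v != 2 -> ~~ suppressed v.
Proof. by rewrite /suppressed => /negPf->. Qed.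

Lemma not_suppressed_nbr v x : x \in nbrs v -> degree x = 2 -> ~~ suppressed v.
Proof. by move=> vx dx; apply/negP => /suppressed_nbr/(_ vx); rewrite dx. Qed.

Lemma in_trace2 u v x : (x \in trace [set u; v]) =
  [|| x == u, x == v, suppressed u && (x \in nbrs u)
    | suppressed v && (x \in nbrs v)].
Proof.
rewrite in_setU in_set2 -orbA; congr [|| _, _ | _].
apply/bigcupP/orP => [[w /andP[]]|].
  by rewrite in_set2 => /orP[]/eqP-> -> ->; [left|right].
by case=> /andP[sw xw]; [exists u|exists v]; rewrite // in_set2 eqxx ?orbT.
Qed.

Lemma trace_plain u v : ~~ suppressed u -> ~~ suppressed v ->
  trace [set u; v] = [set u; v].
Proof.
move=> su sv; apply/setP => x.
by rewrite in_trace2 in_set2 (negPf su) (negPf sv) !orbF.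
Qed.

(** The right-hand side does not mention [u]: both edges at [v] have the same trace, hence the same
    color. *)
Lemma trace_suppressed u v : suppressed v -> u \in nbrs v ->
  trace [set u; v] = v |: nbrs v.
Proof.
move=> sv vu; apply/setP => x.
rewrite in_trace2 in_setU1 sv (negPf (not_suppressed (suppressed_nbr sv vu))) /=.
by case: (eqVneq x u) => [->|]; rewrite ?vu ?orbT.
Qed.

(* The edges whose color must differ from that of [uv] because of what lies
   beyond the endpoint [v]. *)
Definition forbid u v : {set {set G}} :=
  if degree v != 2 then [set [set v; x] | x in blockmates v u]
  else if suppressed v then set0
  else \bigcup_(x in nbrs v :\ u)
    (if degree x == 2 then [set [set x; y] | y in nbrs x :\ v]
     else [set [set x; y] | y in last3 x]).

Variant forbid_spec u v : {set G} -> Prop :=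
| ForbidBlock x of degree v != 2 & x \in blockmates v u :
    forbid_spec u v [set v; x]
| ForbidThread x y of degree v = 2 & x \in nbrs v & x != u & degree x = 2
    & y \in nbrs x & y != v : forbid_spec u v [set x; y]
| ForbidLast x y of degree v = 2 & degree u = 2 & x \in nbrs v & x != u
    & degree x != 2 & y \in last3 x : forbid_spec u v [set x; y].

Lemma forbidP u v B : u \in nbrs v ->
  reflect (forbid_spec u v B) (B \in forbid u v).
Proof.
move=> vu; rewrite /forbid; apply: (iffP idP).
  case: ifPn => [dv /imsetP[x xm ->]|]; first exact: ForbidBlock.
  rewrite negbK => /eqP dv; case: ifPn => [_|ns]; first by rewrite in_set0.
  case/bigcupP=> x; rewrite in_setD1 => /andP[xu vx]; case: ifPn => [/eqP dx|dx].
    by case/imsetP=> y; rewrite in_setD1 => /andP[yv xy] ->; apply: ForbidThread.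
  (* If [degree u] were not 2, both neighbors of [v] would have degree other than 2 and [v] would be
     suppressed. *)
  case/imsetP=> y yl ->; apply: ForbidLast => //; apply/eqP.
  by apply: contraNT ns => du; apply: two_nbrs_suppressed xu du dx.
case=> [x dv xm|x y dv vx xu dx xy yv|x y dv du vx xu dx yl].
- by rewrite dv; apply: imset_f.
- rewrite dv eqxx /= (negPf (not_suppressed_nbr vx dx)).
  apply/bigcupP; exists x; first by rewrite in_setD1 xu.
  by rewrite dx eqxx; apply: imset_f; rewrite in_setD1 yv.
- rewrite dv eqxx /= (negPf (not_suppressed_nbr vu du)).
  apply/bigcupP; exists x; first by rewrite in_setD1 xu.
  by rewrite (negPf dx); apply: imset_f.
Qed.

Lemma card_forbid u v : u \in nbrs v -> #|forbid u v| <= 3.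
Proof.
move=> vu; rewrite /forbid; case: ifPn => [dv|].
  exact: leq_trans (leq_imset_card _ _) (card_blockmates vu).
rewrite negbK => /eqP dv; case: ifPn => [_|ns]; first by rewrite cards0.
have [x Ex] := degree2_other dv vu; rewrite Ex big_set1.
case: ifPn => [/eqP dx|dx]; apply: leq_trans (leq_imset_card _ _) _.
  by rewrite (leq_trans (subset_leq_card (subD1set _ _))) // card_nbrs dx.
exact: card_last3.
Qed.

(** In the block case, equal traces would make [u] and [x] adjacent and both suppressed, but a
    suppressed vertex has no neighbor of degree 2. In the other cases neither [u] nor [v] is
    suppressed, so the trace of [uv] is just the edge, which misses [x]. *)
Lemma trace_forbid u v B : u \in nbrs v -> B \in forbid u v ->
  trace [set u; v] != trace B.
Proof.
move=> vu /(forbidP _ vu)[x dv xm|x y dv vx xu dx xy yv|x y dv du vx xu dx yl].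
- move: xm; rewrite inE => /and3P[vx xu _]; apply: contraNneq (xu) => E.
  have := sub_trace [set v; x]; rewrite -E => /subsetP/(_ x).
  rewrite in_set2 eqxx orbT => /(_ isT); rewrite in_trace2.
  rewrite (negPf xu) [x == v]eq_sym (negPf (nbrs_neq vx)).
  rewrite (negPf (not_suppressed dv)) /= orbF => /andP[su ux].
  have := sub_trace [set u; v]; rewrite E => /subsetP/(_ u).
  rewrite in_set2 eqxx => /(_ isT); rewrite in_trace2.
  rewrite [u == v]eq_sym (negPf (nbrs_neq vu)) [u == x]eq_sym (negPf xu).
  rewrite (negPf (not_suppressed dv)) /= => /andP[/suppressed_degree dx _].
  by have := suppressed_nbr su ux; rewrite dx.
- have sv := not_suppressed_nbr vx dx; have uv : v \in nbrs u by rewrite nbrsC.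
  rewrite (trace_plain (not_suppressed_nbr uv dv) sv).
  apply: contraTneq (sub_trace [set x; y]) => <-; apply/subsetPn; exists x.
    by rewrite in_set2 eqxx.
  by rewrite in_set2 negb_or xu eq_sym nbrs_neq.
- have sv := not_suppressed_nbr vu du; have uv : v \in nbrs u by rewrite nbrsC.
  rewrite (trace_plain (not_suppressed_nbr uv dv) sv).
  apply: contraTneq (sub_trace [set x; y]) => <-; apply/subsetPn; exists x.
    by rewrite in_set2 eqxx.
  by rewrite in_set2 negb_or xu eq_sym nbrs_neq.
Qed.

(** * The conflict relation on traces and its greedy coloring *)

Definition conflict Z Z' := [exists u, exists v,
  [&& u \in nbrs v, Z == trace [set u; v] & Z' \in trace @: forbid u v]].

Lemma conflictP Z Z' : reflect (exists u v B,
    [/\ u \in nbrs v, Z = trace [set u; v], B \in forbid u v & Z' = trace B])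
  (conflict Z Z').
Proof.
apply: (iffP existsP) => [[u /existsP[v /and3P[vu /eqP-> /imsetP[B fB ->]]]]|].
  by exists u, v, B.
case=> u [v [B [vu -> fB ->]]]; exists u; apply/existsP; exists v.
by rewrite vu eqxx; apply: imset_f.
Qed.

(** The trace is a path through [v] with ends [u] and [x]. Nothing is forbidden at [v] itself, so at
    most three conflicts arise beyond each end. *)
Lemma card_conflict_suppressed u v : suppressed v -> u \in nbrs v ->
  #|[set Z | conflict (trace [set u; v]) Z]| <= 6.
Proof.
move=> sv vu; have [x Ex] := degree2_other (suppressed_degree sv) vu.
have vx : x \in nbrs v by have: x \in nbrs v :\ u by [rewrite Ex set11];
  case/setD1P.
have sub : [set Z | conflict (trace [set u; v]) Z] \subset
    trace @: forbid v u :|: trace @: forbid v x.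
  apply/subsetP=> Z; rewrite inE => /conflictP[u' [v' [B [vu' E fB ->]]]].
  rewrite trace_suppressed // in E.
  have := sub_trace [set u'; v']; rewrite -E subUset !sub1set.
  case/andP=> /setU1P Hu /setU1P Hv.
  case: Hv => [Ev|Hv].
    by move: fB; rewrite Ev /forbid suppressed_degree //= sv in_set0.
  case: Hu => [Eu|Hu].
    rewrite Eu in fB; have: v' \in u |: (nbrs v :\ u) by rewrite setD1K.
    rewrite Ex in_set2 => /orP[]/eqP Ev; rewrite Ev in fB.
      by rewrite inE imset_f.
    by rewrite inE orbC imset_f.
  (* Remaining case: [u'] and [v'] are both neighbors of [v], forming a triangle with it. Neither is
     suppressed, so the trace of their edge would miss [v]. *)
  have: v \in trace [set u'; v'] by rewrite -E setU11.
  rewrite trace_plain ?(not_suppressed (suppressed_nbr sv _)) //.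
  by rewrite in_set2 (negPf (nbrs_neq Hu)) (negPf (nbrs_neq Hv)).
apply: leq_trans (subset_leq_card sub) _.
rewrite cardsU; apply: leq_trans (leq_subr _ _) _.
rewrite -[6]/(3 + 3); apply: leq_add;
  by rewrite (leq_trans (leq_imset_card _ _)) // card_forbid // nbrsC.
Qed.

Lemma card_conflict Z : #|[set Z' | conflict Z Z']| <= 6.
Proof.
case: (set_0Vmem [set Z' | conflict Z Z']) => [->|[Z0]]; first by rewrite cards0.
(* A single conflict already shows that [Z] is the trace of some edge [uv]. *)
rewrite inE => /conflictP[u [v [_ [vu -> _ _]]]] {Z0 Z}.
have uv : v \in nbrs u by rewrite nbrsC.
have [sv|sv] := boolP (suppressed v); first exact: card_conflict_suppressed.
have [su|su] := boolP (suppressed u).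
  by rewrite setUC; apply: card_conflict_suppressed.
have sub : [set Z | conflict (trace [set u; v]) Z] \subset
    trace @: forbid u v :|: trace @: forbid v u.
  apply/subsetP=> Z; rewrite inE => /conflictP[u' [v' [B [vu' E fB ->]]]].
  rewrite trace_plain // in E.
  have := sub_trace [set u'; v']; rewrite -E subUset !sub1set !in_set2.
  have := nbrs_neq vu'; rewrite in_setU.
  move=> neq /andP[/orP[]/eqP Eu /orP[]/eqP Ev]; rewrite Eu Ev ?eqxx // in neq fB.
    by rewrite imset_f.
  by rewrite orbC imset_f.
apply: leq_trans (subset_leq_card sub) _.
rewrite cardsU; apply: leq_trans (leq_subr _ _) _.
rewrite -[6]/(3 + 3); apply: leq_add;
  by rewrite (leq_trans (leq_imset_card _ _)) // card_forbid.
Qed.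

(** Read as 0 or 1, this is the level in the greedy coloring: edges with both ends of degree 2 are
    colored last. *)
Definition light Z := [forall x in Z, degree x == 2].

(** Block and thread conflicts are symmetric. The conflicts with [last3] go from a light edge to an
    edge with an end of degree other than 2, which is colored earlier. *)
Lemma conflict_sym Z Z' : conflict Z Z' -> conflict Z' Z \/ light Z' < light Z.
Proof.
case/conflictP=> u [v [B [vu -> + ->]]]; have uv : v \in nbrs u by rewrite nbrsC.
case/(forbidP _ vu) => [x dv|x y dv vx xu dx xy yv|x y dv du vx xu dx yl].
- rewrite inE => /and3P[vx xu bx]; left; apply/conflictP.
  exists x, v, [set v; u]; split; rewrite 1?[[set v; _]]setUC //.
  rewrite setUC; apply/forbidP => //; apply: ForbidBlock => //.
  by rewrite inE vu eq_sym xu eq_sym.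
- left; apply/conflictP; exists y, x, [set v; u].
  split; rewrite 1?[[set v; _]]setUC 1?[[set x; _]]setUC //.
  rewrite setUC; apply/forbidP => //; apply: ForbidThread => //.
  + by rewrite nbrsC.
  + by rewrite eq_sym.
  + by rewrite eq_sym.
- right; rewrite (@trace_plain u v); last first.
  + exact: not_suppressed_nbr vu du.
  + exact: not_suppressed_nbr uv dv.
  have -> : light [set u; v].
    by apply/forall_inP=> z; rewrite in_set2 => /orP[]/eqP->; apply/eqP.
  suff /negPf-> : ~~ light (trace [set x; y]) by [].
  by apply/forall_inPn; exists x; rewrite // in_trace2 eqxx.
Qed.

Lemma ex_separating_coloring : exists c : {set G} -> 'I_7,
  forall u v B, u \in nbrs v -> B \in forbid u v ->
  c (trace [set u; v]) != c (trace B).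
Proof.
have [c cP] := greedy_coloring card_conflict conflict_sym.
exists c => u v B vu fB; apply: cP; last exact: trace_forbid.
by apply/conflictP; exists u, v, B.
Qed.

(** * Counting adjacent edges and checking the majority condition *)

(** An edge other than [e] meets it in only one end, so the two sides are disjoint. [P] will select
    one color class, or, as [predT], all adjacent edges. *)
Lemma card_edge_adjacent (P : pred {set G}) (e : edge G) u v :
    val e = [set u; v] -> v \in nbrs u ->
  #|[set f | edge_adjacent e f & P (val f)]| =
    #|[set x in nbrs u :\ v | P [set u; x]]|
    + #|[set x in nbrs v :\ u | P [set v; x]]|.
Proof.
move=> Ee uv; have neq_uv := nbrs_neq uv; have vu : u \in nbrs v by rewrite nbrsC.
have inj w (S : {set G}) : {in S &, injective (fun x => [set w; x])}.
  move=> x y _ _ E; have: x \in [set w; y] by rewrite -E set22.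
  have: y \in [set w; x] by rewrite E set22.
  by rewrite !in_set2 => /orP[]/eqP-> // /orP[]/eqP.
rewrite -(card_imset _ val_inj) -(card_in_imset (inj u _)).
rewrite -(card_in_imset (inj v _)) -cardsUI.
set I := _ :&: _; have -> : I = set0.
  apply/setP=> A; rewrite in_set0; apply/negP=> /setIP[].
  case/imsetP=> x; rewrite inE in_setD1 => /andP[/andP[xv ux] _] ->.
  case/imsetP=> y; rewrite inE in_setD1 => /andP[/andP[yu vy] _] /setP/(_ v).
  by rewrite !in_set2 eqxx eq_sym (negPf neq_uv) eq_sym (negPf xv).
rewrite cards0 addn0; congr #|pred_of_set _|; apply/setP=> A.
apply/imsetP/setUP => [[f]|].
  rewrite inE => /andP[/andP[ef /set0Pn[w /setIP[we wf]]] Pf ->].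
  have [x wx Ef] : exists2 x, x \in nbrs w & val f = [set w; x].
    move: wf; have [a [b [ab ->]]] := edgeP f; rewrite in_set2 => /orP[]/eqP->.
      by exists b; rewrite ?inE.
    by exists a; rewrite 1?setUC // inE adjacent_sym.
  have {ef} nx : [set u; v] != [set w; x].
    by apply: contraNneq ef; rewrite -Ef -Ee => /val_inj->.
  move: we; rewrite Ee in_set2 => /orP[]/eqP Ew; [left|right];
    apply/imsetP; exists x; rewrite -Ew // inE -Ef Pf in_setD1 wx !andbT;
    apply: contraNneq nx => ->; by rewrite Ew // setUC.
case=> /imsetP[x]; rewrite inE in_setD1 => /andP[/andP[nx wx] Px] ->.
- move: (wx); rewrite in_nbrs => /edge_ex[f Ef]; exists f => //.
  rewrite inE Ef Px andbT /edge_adjacent Ee Ef; apply/andP; split; last first.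
    by apply/set0Pn; exists u; rewrite inE !in_set2 eqxx.
  apply: contraNneq nx => ef; move: Ef; rewrite -ef Ee => /setP/(_ v).
  by rewrite !in_set2 eqxx orbT [v == u]eq_sym (negPf neq_uv) eq_sym.
- move: (wx); rewrite in_nbrs => /edge_ex[f Ef]; exists f => //.
  rewrite inE Ef Px andbT /edge_adjacent Ee Ef; apply/andP; split; last first.
    by apply/set0Pn; exists v; rewrite inE !in_set2 eqxx orbT.
  apply: contraNneq nx => ef; move: Ef; rewrite -ef Ee => /setP/(_ u).
  by rewrite !in_set2 eqxx (negPf neq_uv) /= eq_sym => /esym/eqP->.
Qed.

Section Count.
Variable c : {set G} -> 'I_7.
Hypothesis cP : forall u v B, u \in nbrs v -> B \in forbid u v ->
  c (trace [set u; v]) != c (trace B).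

Let col u v := c (trace [set u; v]).
Let colored a u v := [set x in nbrs u :\ v | col u x == a].

Let colC u v : col u v = col v u.
Proof. by rewrite /col setUC. Qed.

Lemma block_col_inj v x y : degree v != 2 -> x \in nbrs v -> y \in nbrs v ->
  col v x = col v y -> block v x = block v y -> x = y.
Proof.
move=> dv vx vy ec eb; apply/eqP; apply: contraTT isT => neq.
have := @cP x v [set v; y] vx; rewrite -/(col x v) -/(col v y) colC ec eqxx.
apply; apply/forbidP => //; apply: ForbidBlock => //.
by rewrite inE vy eq_sym neq eb eqxx.
Qed.

Lemma coloredP a u v x : x \in colored a u v ->
  [/\ x \in nbrs u, x != v & col u x = a].
Proof. by rewrite inE in_setD1 => /andP[/andP[-> ->] /eqP]. Qed.

Lemma colored_le_degree a u v : v \in nbrs u -> #|colored a u v| < degree u.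
Proof.
move=> uv; rewrite -card_nbrs (cardsD1 v (nbrs u)) uv ltnS; apply: subset_leq_card.
by apply/subsetP=> x; rewrite inE => /andP[].
Qed.

Lemma card_colored a u v : degree u != 2 ->
  4 * #|colored a u v| <= degree u + 3.
Proof.
move=> du; apply: (@card_separated u) => [x y /coloredP[ux _ cx]|x].
  by case/coloredP=> uy _ cy; apply: block_col_inj => //; rewrite cx cy.
by case/coloredP=> /rank_lt.
Qed.

(** The edge [uv] has this color too, so it uses up one of the ceil(d/4) occurrences at [u]. *)
Lemma card_colored_own u v : degree u != 2 -> v \in nbrs u ->
  4 * #|colored (col u v) u v| < degree u.
Proof.
move=> du uv; set S := colored _ _ _.
suff: 4 * #|v |: S| <= degree u + 3.
  by rewrite cardsU1 !inE eqxx /=; lia.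
have SP x : x \in v |: S -> x \in nbrs u /\ col u x = col u v.
  by case/setU1P=> [->//|/coloredP[]].
apply: (@card_separated u) => [x y /SP[ux cx]|x /SP[ux _]]; last exact: rank_lt.
by case/SP=> uy cy; apply: block_col_inj => //; rewrite cx cy.
Qed.

(** The color occurs only at ranks below [degree u - 3]. Subtraction is truncated, so for degree
    below 3 the bound is 3. *)
Lemma card_colored_last a u v : degree u != 2 ->
    {in last3 u, forall x, col u x != a} ->
  4 * #|colored a u v| <= (degree u - 3) + 3.
Proof.
move=> du noa; apply: (@card_separated u) => [x y /coloredP[ux _ cx]|x].
  by case/coloredP=> uy _ cy; apply: block_col_inj => //; rewrite cx cy.
case/coloredP=> ux _ cx; rewrite ltnNge; apply: contraTN isT => le.
by have := noa x; rewrite inE ux cx eqxx => /(_ ltac:(lia)).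
Qed.

Lemma colored_degree2 a u v : degree v = 2 -> u \in nbrs v ->
  exists x, [/\ x \in nbrs v, x != u & #|colored a v u| = (col v x == a)].
Proof.
move=> dv vu; have [x Ex] := degree2_other dv vu; exists x.
have /setD1P[xu vx] : x \in nbrs v :\ u by rewrite Ex set11.
split=> //; rewrite /colored Ex; case: eqP => [cx|cx]; last first.
  by apply: eq_card0 => y; rewrite inE in_set1; case: eqP => // ->; apply/eqP.
apply/eqP/cards1P; exists x; apply/setP=> y; rewrite inE !in_set1.
by case: eqP => // ->; rewrite cx eqxx.
Qed.

Lemma majority_heavy_light a u v : 2 < degree u -> degree v = 2 ->
  u \in nbrs v -> 2 * (#|colored a u v| + #|colored a v u|) <= degree u.
Proof.
move=> du dv vu; have uv : v \in nbrs u by rewrite nbrsC.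
have du2 : degree u != 2 by rewrite gtn_eqF.
have [x [vx xu ->]] := colored_degree2 a dv vu.
case: eqP => [cx|_]; last by have := card_colored a v du2; lia.
have [Ea|Na] := eqVneq (col u v) a.
  by have := card_colored_own du2 uv; rewrite Ea; lia.
(* Otherwise [v] would be suppressed, and [uv] would share the color [a] of [vx]. *)
have dx : degree x = 2.
  apply/eqP; apply: contraNT Na => dx; apply/eqP; rewrite -cx /col.
  have sv : suppressed v := two_nbrs_suppressed dv vu vx xu du2 dx.
  by rewrite trace_suppressed // [[set v; x]]setUC trace_suppressed.
have xv : v \in nbrs x by rewrite nbrsC.
(* Now [xv] is light, and its color [a] avoids those of the last three edges around [u]. This
   compensates for the occurrence of [a] on [vx]. *)
suff noa : {in last3 u, forall y, col u y != a}.
  by have := card_colored_last v du2 noa; lia.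
move=> y uy; rewrite -cx eq_sym colC; apply: cP => //.
by apply/forbidP => //; apply: ForbidLast => //; rewrite eq_sym.
Qed.

(** The only two edges adjacent to [uv] are at distance one along a thread, so their colors
    differ. *)
Lemma majority_light a u v : degree u = 2 -> degree v = 2 ->
  u \in nbrs v -> #|colored a u v| + #|colored a v u| <= 1.
Proof.
move=> du dv vu; have uv : v \in nbrs u by rewrite nbrsC.
have [x [vx xu ->]] := colored_degree2 a dv vu.
have [w [uw wv ->]] := colored_degree2 a du uv.
case: eqP => [cx|_]; case: eqP => [cw|_] //.
have wu : u \in nbrs w by rewrite nbrsC.
suff: col w u != col v x by rewrite colC cw cx eqxx.
by apply: cP => //; apply/forbidP => //; apply: ForbidThread; rewrite // eq_sym.
Qed.

Lemma majority (admG : admissible G) a u v : v \in nbrs u ->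
  2 * (#|colored a u v| + #|colored a v u|) <= (degree u).-1 + (degree v).-1.
Proof.
have deg1 x y : y \in nbrs x -> degree y = 2 -> degree x != 1.
  move=> xy dy; apply: contraNneq admG => dx.
  by apply/existsP; exists x; apply/existsP; exists y; rewrite -in_nbrs xy dx dy.
move=> uv; have vu : u \in nbrs v by rewrite nbrsC.
have lu := colored_le_degree a uv; have lv := colored_le_degree a vu.
case: (eqVneq (degree u) 2) (eqVneq (degree v) 2) => [du|du] [dv|dv].
- by have := majority_light a du dv vu; lia.
- have := deg1 _ _ vu du => d1.
  have := @majority_heavy_light a v u ltac:(lia) du uv; lia.
- have := deg1 _ _ uv dv => d1.
  have := @majority_heavy_light a u v ltac:(lia) dv vu; lia.
(* For d at least 3, ceil(d/4) is at most (d-1)/2; for d = 1 the bounds [lu] and [lv] leave no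
   occurrence at all. *)
- by have := card_colored a v du; have := card_colored a u dv; lia.
Qed.

End Count.

Lemma admissible_majority_coloring : admissible G ->
  exists c : {ffun edge G -> 'I_7}, strong_majority c.
Proof.
move=> admG; have [c cP] := ex_separating_coloring.
exists [ffun e => c (trace (val e))]; apply/forallP=> e; apply/forallP=> a.
have [u [v [uv Ee]]] := edgeP e; rewrite -in_nbrs in uv.
have vu : u \in nbrs v by rewrite nbrsC.
pose P A := c (trace A) == a.
have -> : [set f | edge_adjacent e f & [ffun e => c (trace (val e))] f == a] =
    [set f | edge_adjacent e f & P (val f)].
  by apply/setP=> f; rewrite !inE ffunE.
have -> : [set f | edge_adjacent e f] =
    [set f | edge_adjacent e f & predT (val f)].
  by apply/setP=> f; rewrite !inE andbT.
rewrite (card_edge_adjacent P Ee uv) (card_edge_adjacent predT Ee uv).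
apply: leq_trans (majority cP admG a uv) _.
have full w z : z \in nbrs w ->
    (degree w).-1 = #|[set x in nbrs w :\ z | predT [set w; x]]|.
  move=> wz; rewrite -card_nbrs (cardsD1 z) wz /=; apply: eq_card => x.
  by rewrite [RHS]inE andbT.
by rewrite (full u v) // (full v u).
Qed.

End MajorityColoring.

Theorem theorem8 (G : sgraph) (admG : admissible G) :
  strong_majority_index admG <= 8.
Proof.
have [c cP] := admissible_majority_coloring admG.
rewrite /strong_majority_index; case: ex_minnP => m _ min.
(* The coloring uses seven colors, one fewer than the bound allows. *)
by apply/leqW/min/existsP; exists c.
Qed.
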